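(* Let $\alpha=(\alpha_1,\dots,\alpha_k) \vDash n$. The number of standard lexical tableaux of shape $\alpha$ is \[ K^{\mathfrak{L}}_{\alpha, 1^n} = \frac{n! \prod_{i =1}^{k} (\alpha_i-1)!}{\prod_{c \in \alpha} h_{\alpha}(c)},\] where the product in the denominator runs over all cells $c$ of the diagram of $\alpha$.
   Context: A composition $\alpha \vDash n$ is a tuple of positive integers summing to $n$; its diagram has left-justified rows, row $i$ having $\alpha_i$ cells; cell $c=(i,j)$ is the $j$-th cell of row $i$. The hook $h_\alpha(c)$ of $c=(i,j)$ is $\alpha_i+\alpha_{i+1}+\cdots+\alpha_k$ if $j=1$, and $\alpha_i-j+1$ if $j>1$. A word $w=w_1\cdots w_m$ is a necklace word if it is lexicographically weakly smallest among all its cyclic shifts $w_{i+1}\cdots w_m w_1\cdots w_i$. A standard lexical tableau of shape $\alpha$ is a filling of the diagram with $1,\dots,n$, each used once, such that the first column strictly increases from row $1$ to row $k$ and each row, read left to right, is a necklace word. $K^{\mathfrak{L}}_{\alpha,1^n}$ denotes their number. *)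

(* Defs.v *)
From mathcomp Require Import all_boot all_order all_algebra.

Set Implicit Arguments.
Unset Strict Implicit.
Unset Printing Implicit Defensive.

Definition is_composition (n : nat) (alpha : seq nat) : bool :=
  all (fun a => 0 < a) alpha && (sumn alpha == n).

(* Rows and columns are numbered from 0: the cell (i, j) of the usual
   1-based convention has row i.-1 and column j.-1. *)
Definition cell (alpha : seq nat) : finType :=
  {i : 'I_(size alpha) & 'I_(nth 0 alpha i)}.

Definition cell_row (alpha : seq nat) (c : cell alpha) : nat := tag c.
Definition cell_col (alpha : seq nat) (c : cell alpha) : nat := tagged c.

Definition hook (alpha : seq nat) (c : cell alpha) : nat :=
  if cell_col c == 0 then sumn (drop (cell_row c) alpha)
  else nth 0 alpha (cell_row c) - (cell_col c).+1 + 1.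

Definition necklace_word (w : seq nat) : bool :=
  [forall i : 'I_(size w), ((w : seqlexi nat) <= rot i w)%O].

(* The value m : 'I_n of a filling stands for the entry m.+1 of {1, ..., n}. *)
Definition filling (alpha : seq nat) (n : nat) : finType :=
  {ffun cell alpha -> 'I_n}.

Definition entry (alpha : seq nat) (n : nat) (T : filling alpha n)
    (c : cell alpha) : nat := (T c).+1.

Definition row_word (alpha : seq nat) (n : nat) (T : filling alpha n)
    (i : 'I_(size alpha)) : seq nat :=
  [seq entry T (Tagged (fun i : 'I_(size alpha) => 'I_(nth 0 alpha i)) j)
     | j <- enum 'I_(nth 0 alpha i)].

Definition standard_lexical_tableau (alpha : seq nat) (n : nat)
    (T : filling alpha n) : bool :=
  [&& [forall m : 'I_n, #|[set c | T c == m]| == 1],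
      [forall c : cell alpha, forall c' : cell alpha,
         [&& cell_col c == 0, cell_col c' == 0 & cell_row c < cell_row c']
           ==> (entry T c < entry T c')]
    & [forall i : 'I_(size alpha), necklace_word (row_word T i)]].

Definition num_standard_lexical_tableaux (alpha : seq nat) (n : nat) : nat :=
  #|[set T : filling alpha n | standard_lexical_tableau T]|.

(* Main.v *)
(** The hooks in columns [j > 1] of a row of length [a] multiply to [(a-1)!], so
    the claim is that the number of tableaux is [n!] divided by the product of
    the sizes of the sets [S_i] of cells in rows [>= i].  Since the entries are
    distinct, a bijective filling is a standard lexical tableau iff, for each [i],
    the first cell [c_i] of row [i] carries the smallest entry of [S_i].  Impose
    these conditions one after the other, from the top row downwards.  Among the
    fillings satisfying the conditions for [j < i], the position of the smallest
    entry of [S_i] is equidistributed: exchanging the entries at [p] and [c_i],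
    both in [S_i], affects no earlier condition, because [c_j] is not in [S_i] and
    [S_i] is contained in [S_j].  So the [i]-th condition divides the count by
    [#|S_i|]. *)

Require Import Defs.
From mathcomp Require Import all_boot all_order all_algebra.
From mathcomp Require Import perm.

Set Implicit Arguments.
Unset Strict Implicit.
Unset Printing Implicit Defensive.

Local Open Scope ring_scope.

(** * Injections with prescribed minima on a decreasing chain of sets *)

Section NestedMinima.

Local Open Scope nat_scope.

Variables (C : finType) (n m : nat) (c : 'I_m -> C) (S : 'I_m -> {set C}).
Hypothesis c_in : forall i, c i \in S i.
Hypothesis c_notin : forall i j : 'I_m, j < i -> c j \notin S i.
Hypothesis S_anti : forall i j : 'I_m, j < i -> S i \subset S j.

Definition min_at (T : {ffun C -> 'I_n}) (p : C) (A : {set C}) : bool :=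
  [forall x in A, T p <= T x].

(** The bound [k] is a natural number rather than an index, so that [k = 0] gives all injections and
    [k = m] imposes every condition. *)
Definition nested_min (k : nat) (T : {ffun C -> 'I_n}) : bool :=
  injectiveb T && [forall j : 'I_m, (j < k) ==> min_at T (c j) (S j)].

Definition swap_entries (p q : C) (T : {ffun C -> 'I_n}) : {ffun C -> 'I_n} :=
  [ffun x => T (tperm p q x)].

Lemma swap_entriesK p q : involutive (swap_entries p q).
Proof. by move=> T; apply/ffunP => x; rewrite !ffunE tpermK. Qed.

Lemma tperm_in (A : {set C}) p q x :
  p \in A -> q \in A -> (tperm p q x \in A) = (x \in A).
Proof. by move=> pA qA; case: tpermP => [->|->|//]; rewrite ?pA ?qA. Qed.

Lemma min_at_swap T (A : {set C}) p q x : p \in A -> q \in A ->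
  min_at (swap_entries p q T) x A = min_at T (tperm p q x) A.
Proof.
move=> pA qA; apply/forall_inP/forall_inP => H y yA.
  have := H (tperm p q y); rewrite !ffunE tpermK; apply.
  by rewrite tperm_in.
by rewrite !ffunE; apply: H; rewrite tperm_in.
Qed.

Lemma nested_min_swap (i : 'I_m) p T : p \in S i ->
  nested_min i T -> nested_min i (swap_entries p (c i) T).
Proof.
move=> pS /andP[/injectiveP Tinj /forallP H]; apply/andP; split.
  by apply/injectiveP => x y; rewrite !ffunE => /Tinj/perm_inj.
apply/forallP => j; apply/implyP => ji.
have /subsetP sS := S_anti ji.
rewrite min_at_swap ?sS // tpermD; first exact: (implyP (H j)).
  by apply: contraTneq pS => ->; exact: c_notin.
by apply: contraTneq (c_in i) => ->; exact: c_notin.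
Qed.

Lemma nested_minS (i : 'I_m) T :
  nested_min i.+1 T = nested_min i T && min_at T (c i) (S i).
Proof.
rewrite /nested_min -andbA; congr (_ && _).
apply/forallP/andP => [H|[/forallP H Hi] j].
  split; last by have := H i; rewrite ltnSn.
  by apply/forallP => j; apply/implyP => ji; apply: (implyP (H j)); exact: ltnW.
rewrite ltnS leq_eqVlt; apply/implyP => /orP[/eqP/val_inj -> //|].
exact: (implyP (H j)).
Qed.

(** Equidistribution: the right side does not depend on [p]. The involution swapping [p] and [c i]
    moves the minimum of [S i] from one cell to the other. *)
Lemma card_min_at (i : 'I_m) p : p \in S i ->
  #|[set T | nested_min i T && min_at T p (S i)]| = #|[set T | nested_min i.+1 T]|.
Proof.
move=> pS; rewrite -(card_imset _ (inv_inj (swap_entriesK p (c i)))).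
apply: eq_card => T; rewrite inE nested_minS.
apply/imsetP/idP => [[U]|/andP[H1 H2]].
  rewrite inE => /andP[H1 H2] ->.
  by rewrite nested_min_swap //= min_at_swap // tpermR.
exists (swap_entries p (c i) T); last by rewrite swap_entriesK.
by rewrite inE nested_min_swap //= min_at_swap // tpermL.
Qed.

Lemma sum_min_at (T : {ffun C -> 'I_n}) (A : {set C}) x : injective T -> x \in A ->
  \sum_(p in A) (min_at T p A : nat) = 1.
Proof.
move=> Tinj xA; case: (arg_minnP (fun y => T y : nat) xA) => q qA Hq.
rewrite (bigD1 q) //= big1 => [|p /andP[pA npq]].
  by rewrite addn0; apply/eqP; rewrite eqb1; apply/forall_inP.
apply/eqP; rewrite eqb0; apply: contra npq => /forall_inP Hp.
by apply/eqP/Tinj/val_inj/eqP; rewrite eqn_leq Hp ?Hq.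
Qed.

Lemma card_nested_minS (i : 'I_m) :
  #|[set T | nested_min i T]| = #|[set T | nested_min i.+1 T]| * #|S i|.
Proof.
rewrite mulnC -sum_nat_const.
(* Double counting of pairs ([T], [p]) with the minimum of [S i] at [p]: each [T] admits exactly one
   such [p]. *)
under eq_bigr => p pS do rewrite -(card_min_at pS) -sum1_card big_mkcond /=.
rewrite exchange_big -sum1_card big_mkcond /=; apply: eq_bigr => T _.
rewrite inE; case: ifP => H.
  have /andP[/injectiveP Tinj _] := H.
  rewrite -[LHS](sum_min_at Tinj (c_in i)); apply: eq_bigr => p _.
  by rewrite inE H; case: min_at.
by rewrite big1 // => p _; rewrite inE H.
Qed.

Theorem card_nested_min :
  #|[set T | nested_min m T]| * \prod_(i < m) #|S i| = n ^_ #|C|.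
Proof.
suff H k (km : k <= m) :
    #|[set T | nested_min k T]| * \prod_(i < m | i < k) #|S i| = n ^_ #|C|.
  by rewrite -(H m) //; congr (_ * _); apply: eq_bigl => i; rewrite ltn_ord.
elim: k km => [_|k IH km].
  (* With no condition imposed, all injections are counted, which gives the falling factorial. *)
  rewrite big_pred0 // muln1 -[n in RHS]card_ord -card_inj_ffuns -sum1_card -[RHS]sum1_card.
  apply: eq_bigl => T; rewrite !inE /nested_min andbC.
  by case: forallP => // -[] j.
rewrite -{}IH; last exact: ltnW.
rewrite (bigD1 (Ordinal km)) //= mulnA.
rewrite -(card_nested_minS (Ordinal km)) /=; congr (_ * _).
by apply: eq_bigl => i; rewrite ltnS -val_eqE /= andbC -ltn_neqAle.
Qed.

End NestedMinima.

(** * From tableaux and hooks to nested minima *)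

Section Diagram.

Local Open Scope nat_scope.

(** Distinct letters let the first letter alone decide the comparison with a proper rotation, and
    the rotation by [i] starts with letter [i]. *)
Lemma necklace_uniqE (w : seq nat) : uniq w ->
  necklace_word w = [forall i : 'I_(size w), nth 0 w 0 <= nth 0 w i].
Proof.
move=> w_uniq; apply/forallP/forallP => H i.
  have := H i; case: w w_uniq i H => [_ []//|x s] _ i _.
  rewrite /rot (drop_nth 0) // cat_cons.
  by rewrite Order.SeqLexiOrder.lexi_cons leEnat => /andP[].
case: w w_uniq i H => [_ []//|x s] xs_uniq i H.
case: (posnP i) => [->|i_gt0]; first by rewrite rot0.
have xi : x < nth 0 (x :: s) i.
  rewrite ltn_neqAle (H i) andbT -[X in X != _]/(nth 0 (x :: s) 0).
  by rewrite nth_uniq // eq_sym -lt0n.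
rewrite /rot (drop_nth 0) // cat_cons.
by rewrite Order.SeqLexiOrder.lexi_cons !leEnat (ltnW xi) leqNgt xi.
Qed.

Lemma sumn_dropE (s : seq nat) (i : nat) :
  sumn (drop i s) = \sum_(r < size s | i <= r) nth 0 s r.
Proof.
elim: s i => [|x s IH] [|i] //=; rewrite ?big_ord0 // big_mkcond big_ord_recl /=.
  by rewrite -[s in LHS](drop0 s) IH.
by rewrite add0n IH [LHS]big_mkcond.
Qed.

Variable alpha : seq nat.

Definition rows_from (i : 'I_(size alpha)) : {set cell alpha} :=
  [set x | i <= cell_row x].

(** This identifies the hook of the first cell of row [i] with the size of a set in the chain. *)
Lemma card_rows_from i : #|rows_from i| = sumn (drop i alpha).
Proof.
rewrite sumn_dropE -sum1_card.
under [RHS]eq_bigr => r _ do rewrite -[nth _ _ _]card_ord -sum1_card.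
rewrite (sig_big_dep (I := 'I_(size alpha)) (J := fun r => 'I_(nth 0 alpha r))
  _ (fun _ _ => true) (fun _ _ => 1)) /=.
by apply: eq_bigl => x; rewrite inE andbT.
Qed.

Lemma card_cell : #|{: cell alpha}| = sumn alpha.
Proof.
rewrite -[alpha in RHS]drop0 sumn_dropE -sum1_card.
under [RHS]eq_bigr => r _ do rewrite -[nth _ _ _]card_ord -sum1_card.
by rewrite (sig_big_dep (I := 'I_(size alpha)) (J := fun r => 'I_(nth 0 alpha r))
  _ (fun _ _ => true) (fun _ _ => 1)).
Qed.

Hypothesis alpha_gt0 : all (fun a => 0 < a) alpha.

Lemma row_gt0 (i : 'I_(size alpha)) : 0 < nth 0 alpha i.
Proof. by apply: (allP alpha_gt0); rewrite mem_nth. Qed.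

Definition row_cell (i : 'I_(size alpha)) (j : 'I_(nth 0 alpha i)) : cell alpha :=
  Tagged (fun i : 'I_(size alpha) => 'I_(nth 0 alpha i)) j.

Definition first_cell (i : 'I_(size alpha)) : cell alpha :=
  row_cell (Ordinal (row_gt0 i)).

Lemma cell_col0 (x : cell alpha) : cell_col x == 0 -> x = first_cell (tag x).
Proof.
case: x => i j /eqP j0; rewrite /first_cell /=; congr existT.
exact: val_inj.
Qed.

Lemma prod_row_hook (h a : nat) : 0 < a ->
  \prod_(j < a) (if (j : nat) == 0 then h else a - j.+1 + 1) = h * (a.-1)`!.
Proof.
case: a => // a _; rewrite big_ord_recl /=; congr (_ * _).
(* The hooks past the first column run down from [a - 1] to 1, so the order is reversed to match the
   factorial. *)
rewrite fact_prod big_add1 big_mkord (reindex_inj rev_ord_inj) /=.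
apply: eq_bigr => j _; rewrite /bump /= add1n addn1 subSS (subnSK (ltn_ord j)) subKn //.
exact: ltnW.
Qed.

Lemma prod_hook : \prod_(x : cell alpha) hook x =
  (\prod_(i < size alpha) #|rows_from i|) * \prod_(a <- alpha) (a.-1)`!.
Proof.
rewrite (big_nth 0) big_mkord -big_split /=.
rewrite -(eq_bigr _ (fun i _ => prod_row_hook _ (row_gt0 i))).
rewrite (sig_big_dep (I := 'I_(size alpha)) (J := fun r => 'I_(nth 0 alpha r))
  _ (fun _ _ => true)) /=.
by apply: eq_bigr => x _; rewrite card_rows_from.
Qed.

Variable n : nat.
Hypothesis sum_alpha : sumn alpha = n.

Lemma bijective_fillingE (T : filling alpha n) :
  [forall m : 'I_n, #|[set x | T x == m]| == 1] = injectiveb T.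
Proof.
apply/forallP/injectiveP => [H x y Txy|Tinj m].
  have /cards1P[z Hz] := H (T x).
  have: x \in [set z] by rewrite -Hz inE.
  have: y \in [set z] by rewrite -Hz inE Txy.
  by rewrite !inE => /eqP-> /eqP->.
have cardT : #|'I_n| = #|{: cell alpha}| by rewrite card_ord card_cell.
have /codomP[x ->] : m \in codom T by rewrite inj_card_onto ?cardT.
by apply/cards1P; exists x; apply/setP => y; rewrite !inE (inj_eq Tinj).
Qed.

Lemma nth_row_word (T : filling alpha n) (i : 'I_(size alpha))
    (j : 'I_(nth 0 alpha i)) :
  nth 0 (row_word T i) j = entry T (row_cell j).
Proof. by rewrite (nth_map j) ?nth_ord_enum // size_enum_ord. Qed.

Lemma necklace_rowE (T : filling alpha n) i : injective T ->
  necklace_word (row_word T i) =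
  [forall j : 'I_(nth 0 alpha i), T (first_cell i) <= T (row_cell j)].
Proof.
move=> Tinj; rewrite necklace_uniqE; last first.
  rewrite map_inj_uniq ?enum_uniq // => j j' [/val_inj/Tinj].
  by move=> /eqP; rewrite eq_Tagged => /eqP.
have sz : size (row_word T i) = nth 0 alpha i by rewrite size_map size_enum_ord.
have head_word : nth 0 (row_word T i) 0 = entry T (first_cell i).
  exact: (nth_row_word T (Ordinal (row_gt0 i))).
apply/forallP/forallP => H j.
  have := H (cast_ord (esym sz) j).
  by rewrite head_word /= nth_row_word.
rewrite -[nat_of_ord j]/(val (cast_ord sz j)).
by rewrite head_word nth_row_word; exact: H.
Qed.

(** Necklace rows put each row minimum in the first column, and the increasing first column compares
    these minima across rows. Conversely, both conditions are special cases of minimality over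
    [rows_from i]. *)
Lemma standard_lexical_tableauE (T : filling alpha n) :
  standard_lexical_tableau T = nested_min first_cell rows_from (size alpha) T.
Proof.
rewrite /standard_lexical_tableau bijective_fillingE /nested_min.
case: injectiveP => //= Tinj.
apply/andP/forallP => [[/forallP Hcol /forallP Hrow] i|H].
  rewrite ltn_ord; apply/forall_inP => -[r j]; rewrite inE /cell_row /= => ir.
  have: necklace_word (row_word T r) by [].
  rewrite necklace_rowE // => /forallP/(_ j); apply: leq_trans.
  case: (eqVneq i r) => [-> //|nir]; apply: ltnW.
  have := forallP (Hcol (first_cell i)) (first_cell r).
  rewrite /cell_row /cell_col /= => /implyP; apply.
  by rewrite ltn_neqAle ir andbT.
have {}H (i : 'I_(size alpha)) (x : cell alpha) : i <= cell_row x -> T (first_cell i) <= T x.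
  by have := H i; rewrite ltn_ord /= => /forall_inP/(_ x); rewrite inE.
split; apply/forallP.
  move=> x; apply/forallP => y; apply/implyP => /and3P[x0 y0 xy].
  (* Minimality gives only a weak inequality; injectivity makes it strict. *)
  rewrite /entry ltnS ltn_neqAle (cell_col0 x0) H ?andbT; last exact: ltnW.
  rewrite -(cell_col0 x0); apply: contraTneq xy => /val_inj/Tinj ->.
  by rewrite ltnn.
move=> i; rewrite necklace_rowE //; apply/forallP => j.
exact: H.
Qed.

Lemma num_standard_lexical_tableaux_rows :
  num_standard_lexical_tableaux alpha n * \prod_(i < size alpha) #|rows_from i|
  = n`!.
Proof.
rewrite -ffactnn -[X in n ^_ X]sum_alpha -card_cell.
rewrite -(@card_nested_min _ n _ first_cell rows_from).
- congr (_ * _); apply: eq_card => T.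
  by rewrite !inE standard_lexical_tableauE.
- by move=> i; rewrite inE.
- by move=> i j ji; rewrite inE -ltnNge.
- by move=> i j ji; apply/subsetP => x; rewrite !inE; apply: leq_trans; exact: ltnW.
Qed.

Lemma rows_from_gt0 i : 0 < #|rows_from i|.
Proof. by apply/card_gt0P; exists (first_cell i); rewrite inE. Qed.

End Diagram.

Theorem theorem3p7 (n : nat) (alpha : seq nat)
    (halpha : is_composition n alpha) :
  (num_standard_lexical_tableaux alpha n)%:R =
  (n`!%:R * \prod_(a <- alpha) (a.-1)`!%:R)
    / (\prod_(c : cell alpha) (hook c)%:R) :> rat.
Proof.
have /andP[alpha_gt0 /eqP sum_alpha] := halpha.
have hook_gt0 : (0 < \prod_(x : cell alpha) hook x)%N.
  rewrite prod_hook // muln_gt0 !prodn_gt0 // => i; last exact: fact_gt0.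
  exact: rows_from_gt0.
(* Clearing the nonzero denominator leaves an identity between natural numbers. *)
rewrite -!GRing.natr_prod; apply: (canRL (GRing.mulfK _)).
  by rewrite Num.Theory.pnatr_eq0 -lt0n.
rewrite -!GRing.natrM prod_hook // mulnA.
by rewrite num_standard_lexical_tableaux_rows.
Qed.
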